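(* Let $m>1$ and let $f_0$ be the initial state, with a positive lower bound. Let $n\in\{0,\dots,N-1\}$ and let $x^n\in\mathcal{Q}$ be given. Then: (1) (Case 1) The scheme: find $x^{n+1}=(x^{n+1}_0,\dots,x^{n+1}_M)$ such that $$\frac{f_{0}(X_{i})}{m\big(\frac{f_0(X)}{\widetilde{D}_h x^{n}}\big)_{i}^{m-1}}\cdot\frac{x^{n+1}_{i}-x^{n}_{i}}{\tau}=-d_{h}\Big(\frac{f_{0}(X)}{D_{h} x^{n+1}}\Big)_{i},\quad 1\le i\le M-1,\qquad x^{n+1}_0=X_0,\ x^{n+1}_M=X_M,$$ is uniquely solvable in $\mathcal{Q}$ (there is exactly one solution $x^{n+1}\in\mathcal{Q}$). (2) (Case 2) The solution $x^{n+1}$ of the linear scheme $$\frac{(\widetilde{D}_h x^n)^{m+1}_i}{m f_0(X_i)^{m}}\cdot\frac{x^{n+1}_{i}-x^{n}_{i}}{\tau}=d_{h}\Big(\frac{D_h x^{n+1}}{f_0(X)}\Big)_{i},\quad 1\le i\le M-1,\qquad x^{n+1}_0=X_0,\ x^{n+1}_M=X_M,$$ also belongs to $\mathcal{Q}$.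
   Context: $\Omega\subset\mathbb{R}$ is a bounded interval with left endpoint $X_0$; $T>0$; $N,M$ are positive integers; $\tau=T/N$ is the time step, $t^n=n\tau$; $h=|\Omega|/M$ is the spatial step; $X_r=X_0+rh$ for integer and half-integer $r$ (so $X_M$ is the right endpoint of $\Omega$). $\mathcal{E}_M$ is the space of real functions $l$ on $\{X_i: i=0,\dots,M\}$, with $l_i=l(X_i)$; $\mathcal{C}_M$ is the space of real functions $\phi$ on $\{X_{i-1/2}: i=1,\dots,M\}$, with $\phi_{i-1/2}=\phi(X_{i-1/2})$. Difference operators: $D_h:\mathcal{E}_M\to\mathcal{C}_M$, $(D_hl)_{i-1/2}=(l_i-l_{i-1})/h$, $1\le i\le M$; $(d_h\phi)_i=(\phi_{i+1/2}-\phi_{i-1/2})/h$, $1\le i\le M-1$, for $\phi\in\mathcal{C}_M$; $\widetilde D_h:\mathcal{E}_M\to\mathcal{E}_M$, $(\widetilde D_hl)_i=(l_{i+1}-l_{i-1})/(2h)$ for $1\le i\le M-1$, $(\widetilde D_hl)_0=(4l_1-l_2-3l_0)/(2h)$, $(\widetilde D_hl)_M=(l_{M-2}-4l_{M-1}+3l_M)/(2h)$. Products, quotients and powers of grid functions are pointwise. The function $f_0$ is evaluated at the points $X_i$ when combined with elements of $\mathcal{E}_M$, and at the half points $X_{i-1/2}$ when combined with elements of $\mathcal{C}_M$. Admissible set: $\mathcal{Q}=\{l\in\mathcal{E}_M: l_{i-1}<l_i \text{ for } 1\le i\le M,\ l_0=X_0,\ l_M=X_M\}$. *)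

(* Defs.v *)
From HB Require Import structures.
From mathcomp Require Import all_boot all_order all_algebra.
From mathcomp Require Import reals exp.

Set Implicit Arguments.
Unset Strict Implicit.
Unset Printing Implicit Defensive.

Import Order.TTheory GRing.Theory Num.Theory.
Local Open Scope ring_scope.

(* A grid function is a tuple of values, u`_k being its k-th component.
   In E_M (the M+1 integer points) component k is the value at X_k.
   In C_M (the M half-integer points) component k is the value at X_{k+1/2};
   equivalently phi_{i-1/2} is phi`_(i.-1) and phi_{i+1/2} is phi`_i. *)
Definition gridE (R : realType) (M : nat) := M.+1.-tuple R.
Definition gridC (R : realType) (M : nat) := M.-tuple R.

Definition gpoint (R : realType) (X0 h r : R) : R := X0 + r * h.

Definition onE (R : realType) (X0 h : R) (M : nat) (f : R -> R) : gridE R M :=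
  [tuple f (gpoint X0 h k%:R) | k < M.+1].

Definition onC (R : realType) (X0 h : R) (M : nat) (f : R -> R) : gridC R M :=
  [tuple f (gpoint X0 h (k%:R + 2^-1)) | k < M].

Definition gdiv (R : realType) (n : nat) (u v : n.-tuple R) : n.-tuple R :=
  [tuple u`_k / v`_k | k < n].

Definition gpow (R : realType) (n : nat) (u : n.-tuple R) (a : R) : n.-tuple R :=
  [tuple u`_k `^ a | k < n].

Definition Dh (R : realType) (h : R) (M : nat) (l : gridE R M) : gridC R M :=
  [tuple (l`_k.+1 - l`_k) / h | k < M].

(* Meaningful for 1 <= i <= M-1 only. *)
Definition dh (R : realType) (h : R) (M : nat) (phi : gridC R M) (i : nat) : R :=
  (phi`_i - phi`_i.-1) / h.

(* The one-sided stencils at both ends need M >= 2; for M = 1 they read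
   out-of-range components, but the schemes then have no equation at all. *)
Definition Dth (R : realType) (h : R) (M : nat) (l : gridE R M) : gridE R M :=
  [tuple if k == 0 :> nat then (4 * l`_1 - l`_2 - 3 * l`_0) / (2 * h)
         else if k == M :> nat then
           (l`_(M - 2) - 4 * l`_(M - 1) + 3 * l`_M) / (2 * h)
         else (l`_k.+1 - l`_k.-1) / (2 * h) | k < M.+1].

Definition admissible (R : realType) (X0 h : R) (M : nat) (l : gridE R M) : Prop :=
  [/\ forall i : nat, (1 <= i <= M)%N -> l`_i.-1 < l`_i,
      l`_0 = X0
    & l`_M = gpoint X0 h M%:R].

Definition scheme1 (R : realType) (X0 h tau m : R) (M : nat) (f0 : R -> R)
    (xn x : gridE R M) : Prop :=
  [/\ forall i : nat, (1 <= i <= M - 1)%N ->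
        f0 (gpoint X0 h i%:R)
          / (m * (gpow (gdiv (onE X0 h M f0) (Dth h xn)) (m - 1))`_i)
          * ((x`_i - xn`_i) / tau)
        = - dh h (gdiv (onC X0 h M f0) (Dh h x)) i,
      x`_0 = X0
    & x`_M = gpoint X0 h M%:R].

Definition scheme2 (R : realType) (X0 h tau m : R) (M : nat) (f0 : R -> R)
    (xn x : gridE R M) : Prop :=
  [/\ forall i : nat, (1 <= i <= M - 1)%N ->
        (gpow (Dth h xn) (m + 1))`_i / (m * f0 (gpoint X0 h i%:R) `^ m)
          * ((x`_i - xn`_i) / tau)
        = dh h (gdiv (Dh h x) (onC X0 h M f0)) i,
      x`_0 = X0
    & x`_M = gpoint X0 h M%:R].

(* Main.v *)
Require Import Defs.
From HB Require Import structures.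
From mathcomp Require Import all_boot all_order all_algebra.
From mathcomp Require Import reals exp.
From mathcomp Require Import boolp classical_sets topology normedtype realfun.
From mathcomp Require Import ring lra zify.

Set Implicit Arguments.
Unset Strict Implicit.
Unset Printing Implicit Defensive.

Import Order.TTheory GRing.Theory Num.Theory.
Import numFieldNormedType.Exports.
Local Open Scope ring_scope.

(** Both schemes are discrete conservation laws in the unknown positions:
    a_i (x_i - x^n_i) = phi_i (x_(i+1) - x_i) - phi_(i-1) (x_i - x_(i-1))
    with positive weights a_i and a flux phi_k that is a nondecreasing function
    of the gap between neighbouring nodes: phi_k (d) = - f_0 / d in Case 1 and
    phi_k (d) = d / (f_0 h^2) in Case 2, f_0 being taken at a half point.

    Monotone fluxes give a comparison principle (balance_comparison): at an
    interior maximum of x - y the right gap of x is at most that of y and its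
    left gap is at least that of y, so the right-hand side for x is at most
    the one for y, and then x <= y there.  Uniqueness follows in both cases.

    Existence in Case 2: the equations can be solved node after node from
    x_0 and x_1, and the result is affine in x_1; its slope at the last node
    is nonzero by uniqueness for the homogeneous problem
    (linear_balance_exists).  The solution is increasing
    (linear_balance_increasing) because at a smallest flux the displacement
    x - x^n cannot decrease from the left node to the right one, so that this
    gap is at least the gap of x^n, which is positive.

    Existence in Case 1: here the fluxes blow up when a gap closes, and the
    system is eliminated from the left.  Once the position y of node k is
    prescribed, the equations at nodes 1, ..., k-1 determine the preceding
    node, hence the gap g_k (y).  The induction carries the property that both
    g_k and y - g_k (y) are nondecreasing (gap_map): monotonicity is what the
    next elimination step preserves (gap_map_extend), and it forces g_k to be
    1-Lipschitz, so the continuity required by the intermediate value theorem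
    (node_solvable) comes for free.  Prescribing the right endpoint at the
    last node gives the solution. *)

(** * Balance laws with monotone fluxes *)

(** The equations are indexed by the left neighbour i of the node i.+1, which
    avoids predecessors. *)
Definition balance (R : realType) (a c : nat -> R) (phi : nat -> R -> R)
    (M : nat) (x : nat -> R) : Prop :=
  forall i, (i.+1 < M)%N ->
    a i.+1 * (x i.+1 - c i.+1)
    = phi i.+1 (x i.+2 - x i.+1) - phi i (x i.+1 - x i).

(** D is the set of gaps on which the fluxes are monotone: the positive numbers
    for - b / d, everything for a linear flux. *)
Lemma balance_comparison (R : realType) (a c : nat -> R)
    (phi : nat -> R -> R) (D : {pred R}) (M : nat) (x y : nat -> R) :
  (forall i, (i.+1 < M)%N -> 0 < a i.+1) ->
  (forall k, (k < M)%N -> {in D &, {homo phi k : u v / u <= v}}) ->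
  (forall k, (k < M)%N -> x k.+1 - x k \in D) ->
  (forall k, (k < M)%N -> y k.+1 - y k \in D) ->
  balance a c phi M x -> balance a c phi M y ->
  x 0 <= y 0 -> x M <= y M ->
  forall i, (i <= M)%N -> x i <= y i.
Proof.
move=> a0 phi_mono Dx Dy Bx By le0 leM i leiM.
case: (@arg_maxP _ _ _ (ord0 : 'I_M.+1) xpredT (fun k : 'I_M.+1 => x k - y k)) => //.
move=> [j /= ltj] _ jmax.
have max k : (k <= M)%N -> x k - y k <= x j - y j.
  by move=> lek; exact: (jmax (Ordinal (lek : (k < M.+1)%N))).
suff : x j - y j <= 0 by have := max i leiM; lra.
case: j ltj {jmax} max => [|j] ltj max; first by lra.
have [ltjM|] := ltnP j.+1 M; last first.
  move=> leMj; have -> : j.+1 = M by lia.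
  by lra.
have ltj' : (j < M)%N by lia.
have := Bx j ltjM; have := By j ltjM.
have h1 : phi j.+1 (x j.+2 - x j.+1) <= phi j.+1 (y j.+2 - y j.+1).
  apply: phi_mono; rewrite ?Dx ?Dy //.
  by have := max j.+2 ltjM; lra.
have h2 : phi j (y j.+1 - y j) <= phi j (x j.+1 - x j).
  apply: phi_mono; rewrite ?Dx ?Dy //.
  by have := max j (ltnW ltj'); lra.
move=> ey ex.
have : a j.+1 * (x j.+1 - y j.+1) <= 0.
  have -> : a j.+1 * (x j.+1 - y j.+1) =
    a j.+1 * (x j.+1 - c j.+1) - a j.+1 * (y j.+1 - c j.+1) by ring.
  by lra.
by rewrite pmulr_rle0 ?a0.
Qed.

Lemma balance_unique (R : realType) (a c : nat -> R)
    (phi : nat -> R -> R) (D : {pred R}) (M : nat) (x y : nat -> R) :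
  (forall i, (i.+1 < M)%N -> 0 < a i.+1) ->
  (forall k, (k < M)%N -> {in D &, {homo phi k : u v / u <= v}}) ->
  (forall k, (k < M)%N -> x k.+1 - x k \in D) ->
  (forall k, (k < M)%N -> y k.+1 - y k \in D) ->
  balance a c phi M x -> balance a c phi M y ->
  x 0 = y 0 -> x M = y M ->
  forall i, (i <= M)%N -> x i = y i.
Proof.
move=> a0 mono Dx Dy Bx By e0 eM i leiM; apply/le_anti/andP; split.
  by apply: (balance_comparison a0 mono Dx Dy Bx By) => //; rewrite ?e0 ?eM.
by apply: (balance_comparison a0 mono Dy Dx By Bx) => //; rewrite ?e0 ?eM.
Qed.

(** * Linear fluxes *)

(** The pair holds the position of node k and the gap to its right; the gap
    is updated by solving the equation at the new node for it. *)
Fixpoint march (R : realType) (a c beta : nat -> R) (x0 d0 : R) (k : nat) :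
    R * R :=
  if k is j.+1 then
    let: (x, d) := march a c beta x0 d0 j in
    (x + d, (beta j * d + a j.+1 * (x + d - c j.+1)) / beta j.+1)
  else (x0, d0).

Lemma march_balance (R : realType) (a c beta : nat -> R) (M : nat)
    (x0 d0 : R) :
  (forall k, (k < M)%N -> 0 < beta k) ->
  balance a c (fun k d => beta k * d) M
    (fun k => (march a c beta x0 d0 k).1).
Proof.
move=> beta0 i lti /=; case: (march a c beta x0 d0 i) => x d /=.
have : beta i.+1 != 0 by rewrite gt_eqF ?beta0.
by move=> ?; field.
Qed.

Lemma linear_balance_comb (R : realType) (a c beta : nat -> R) (M : nat)
    (v w : nat -> R) (s : R) :
  balance a c (fun k d => beta k * d) M v ->
  balance a (fun=> 0) (fun k d => beta k * d) M w ->
  balance a c (fun k d => beta k * d) M (fun k => v k + s * w k).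
Proof.
move=> Bv Bw i lti; have := Bv i lti; have := Bw i lti => /= ew ev.
transitivity (a i.+1 * (v i.+1 - c i.+1) + s * (a i.+1 * (w i.+1 - 0))).
  by ring.
by rewrite ev ew; ring.
Qed.

Lemma linear_balance_exists (R : realType) (a c beta : nat -> R) (M : nat)
    (x0 xM : R) :
  (0 < M)%N ->
  (forall i, (i.+1 < M)%N -> 0 < a i.+1) ->
  (forall k, (k < M)%N -> 0 < beta k) ->
  exists x : nat -> R,
    [/\ balance a c (fun k d => beta k * d) M x, x 0 = x0 & x M = xM].
Proof.
move=> M0 a0 beta0.
(* v carries the data c with a zero first gap, w is the response of the
   homogeneous problem to a unit first gap. *)
pose v k := (march a c beta x0 0 k).1.
pose w k := (march a (fun=> 0) beta 0 1 k).1.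
have Bv : balance a c (fun k d => beta k * d) M v by exact: march_balance.
have Bw : balance a (fun=> 0) (fun k d => beta k * d) M w.
  exact: march_balance.
have wM : w M != 0.
  apply/eqP => wM0.
  (* Otherwise w and 0 solve the same homogeneous boundary value problem. *)
  have w1 : w 1 = 0.
    have phi_mono k : (k < M)%N -> {in predT &, {homo *%R (beta k) : u v / u <= v}}.
      by move=> ltk u v' _ _ le_uv; rewrite ler_pM2l ?beta0.
    have B0 : balance a (fun=> 0) (fun k d => beta k * d) M (fun=> 0).
      by move=> i _; rewrite !subr0 !mulr0 subr0.
    exact: (balance_unique a0 phi_mono _ _ Bw B0 _ _ M0).
  by move/eqP: w1; rewrite /w /= add0r oner_eq0.
exists (fun k => v k + (xM - v M) / w M * w k); split.
- exact: linear_balance_comb.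
- by rewrite /v /w /= mulr0 addr0.
- by rewrite divfK // addrC subrK.
Qed.

(** Minimum principle for the flux q_k = beta_k (x_(k+1) - x_k).  Where q is
    smallest it does not decrease to the right nor increase from the left, so
    x - c is nonnegative at the right node and nonpositive at the left one, an
    end node contributing x - c = 0.  Hence x_(k+1) - x_k >= c_(k+1) - c_k > 0
    and the smallest flux is positive. *)
Lemma linear_balance_increasing (R : realType) (a c beta : nat -> R)
    (M : nat) (x : nat -> R) :
  (forall i, (i.+1 < M)%N -> 0 < a i.+1) ->
  (forall k, (k < M)%N -> 0 < beta k) ->
  (forall k, (k < M)%N -> c k < c k.+1) ->
  balance a c (fun k d => beta k * d) M x ->
  x 0 = c 0 -> x M = c M ->
  forall k, (k < M)%N -> x k < x k.+1.
Proof.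
move=> a0 beta0 cinc Bx e0 eM k ltkM.
pose q j := beta j * (x j.+1 - x j).
case: (@arg_minP _ _ _ (Ordinal ltkM : 'I_M) xpredT (fun k : 'I_M => q k)) => //.
move=> [j /= ltj] _ jmin.
have min i : (i < M)%N -> q j <= q i.
  by move=> lti; exact: (jmin (Ordinal lti)).
suff qj : 0 < q j.
  have := lt_le_trans qj (min k ltkM).
  by rewrite /q pmulr_rgt0 ?beta0 // subr_gt0.
rewrite ltNge; apply/negP => qj0.
have right : 0 <= x j.+1 - c j.+1.
  have [ltjM|leMj] := ltnP j.+1 M; last first.
    by have -> : j.+1 = M by [lia]; rewrite eM subrr.
  rewrite -(pmulr_rge0 _ (a0 j ltjM)) (Bx j ltjM) subr_ge0.
  exact: min.
have left : x j - c j <= 0.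
  case: j ltj {qj0 jmin right} min => [|j] ltj min; first by rewrite e0 subrr.
  rewrite -(pmulr_rle0 _ (a0 j ltj)) (Bx j ltj) subr_le0.
  by apply: min; lia.
have := cinc j ltj; move: qj0.
by rewrite /q pmulr_rle0 ?beta0 //; lra.
Qed.

(** * Reciprocal fluxes *)

(** g y is the gap to the left of a node placed at y.  The value 0 to the left
    of X0 makes g total and continuous across X0. *)
Definition gap_map (R : realType) (X0 : R) (g : R -> R) : Prop :=
  [/\ forall y, X0 < y -> 0 < g y,
      forall y, y <= X0 -> g y = 0,
      {homo g : u v / u <= v}
    & {homo (fun y => y - g y) : u v / u <= v}].

(** g and y - g y being both nondecreasing, g is 1-Lipschitz. *)
Lemma gap_map_continuous (R : realType) (X0 : R) (g : R -> R) :
  gap_map X0 g -> continuous g.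
Proof.
case=> _ _ gm gm' y; apply/cvgrPdist_le => e e0.
near=> z.
have : `|y - z| <= e by near: z; exact: cvgr_dist_le.
have [le|/ltW le] := leP y z.
  rewrite distrC ger0_norm ?subr_ge0 // distrC ger0_norm ?subr_ge0 ?gm //.
  by have := gm' _ _ le; lra.
rewrite !ger0_norm ?subr_ge0 ?gm //.
by have := gm' _ _ le; lra.
Unshelve. all: by end_near. Qed.

(** The equation at node z, its right neighbour y being fixed.  The two poles,
    at z = X0 and at z = y, have opposite signs; clearing the denominators
    turns them into values of opposite signs of a continuous function. *)
Lemma node_solvable (R : realType) (X0 a c b b' : R) (g : R -> R) (y : R) :
  gap_map X0 g -> 0 < b -> 0 < b' -> X0 < y ->
  exists2 z, X0 < z < y & a * (z - c) = b / g z - b' / (y - z).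
Proof.
move=> gg b0 b'0 lty.
pose F z := a * (z - c) * (y - z) * g z + b' * g z - b * (y - z).
have [gpos g0 _ _] := gg.
have Fc : continuous F.
  move=> z; have gz := gap_map_continuous gg (x := z).
  have idz : ((fun t : R => t) @ z --> z)%classic by exact: cvg_id.
  have cst (t : R) : ((fun=> t : R) @ z --> t)%classic by exact: cvg_cst.
  apply: cvgB; last by apply: cvgM => //; exact: cvgB.
  apply: cvgD; last exact: cvgM.
  apply: cvgM => //; apply: cvgM; last exact: cvgB.
  by apply: cvgM => //; exact: cvgB.
have FX : F X0 < 0 by rewrite /F g0 // !mulr0 add0r sub0r oppr_lt0 mulr_gt0 // subr_gt0.
have Fy : 0 < F y by rewrite /F subrr !mulr0 mul0r add0r subr0 mulr_gt0 ?gpos.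
have [|z] := @IVT _ F X0 y 0 (ltW lty) (continuous_subspaceT Fc).
  by rewrite ge_min le_max (ltW FX) (ltW Fy) orbT.
rewrite in_itv /= => /andP[zX zy] Fz.
have zX' : X0 < z.
  by rewrite lt_neqAle zX andbT; apply/eqP => e; move: Fz FX; rewrite e => ->; rewrite ltxx.
have zy' : z < y.
  by rewrite lt_neqAle zy andbT; apply/eqP => e; move: Fz Fy; rewrite e => ->; rewrite ltxx.
exists z; first by rewrite zX'.
have gz0 : g z != 0 by rewrite gt_eqF ?gpos.
have yz0 : y - z != 0 by rewrite gt_eqF ?subr_gt0.
apply: (mulIf gz0); apply: (mulIf yz0).
have -> : (b / g z - b' / (y - z)) * g z * (y - z) = b * (y - z) - b' * g z.
  by field; rewrite gz0 yz0.
by move: Fz; rewrite /F; lra.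
Qed.

(** One elimination step: Z y solves the equation at the node whose right
    neighbour is y.  The quotient b' / (y - Z y) equals b / g z - a (z - c) at
    z = Z y, a strictly decreasing function of z.  If Z decreased while y
    increases, this quotient would grow although its gap widens; so Z is
    nondecreasing, then the quotient is nonincreasing and the gap y - Z y is
    nondecreasing. *)
Lemma gap_map_extend (R : realType) (X0 a c b b' : R) (g : R -> R) :
  gap_map X0 g -> 0 < a -> 0 < b -> 0 < b' ->
  exists2 g', gap_map X0 g' & forall y, X0 < y ->
    X0 < y - g' y /\ a * (y - g' y - c) = b / g (y - g' y) - b' / g' y.
Proof.
move=> gg a0 b0 b'0; have [gpos g0 gm _] := gg.
have /choice[Z HZ] : forall y, exists z,
    (y <= X0 -> z = y) /\ (X0 < y ->
     X0 < z < y /\ a * (z - c) = b / g z - b' / (y - z)).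
  move=> y; have [le|lt] := leP y X0; first by exists y.
  by have [z zy ez] := node_solvable a c gg b0 b'0 lt; exists z.
have ZN y : y <= X0 -> Z y = y by case: (HZ y).
have ZP y : X0 < y -> X0 < Z y < y /\ a * (Z y - c) = b / g (Z y) - b' / (y - Z y).
  by case: (HZ y).
have inflow z z' : X0 < z -> z <= z' ->
    b / g z' - a * (z' - c) <= b / g z - a * (z - c).
  move=> ltz le; apply: lerB; last by rewrite ler_pM2l // lerD2r.
  rewrite ler_pM2l // lef_pV2 ?posrE ?gpos ?gm //.
  exact: lt_le_trans le.
have outflow u v : X0 < u -> X0 < v ->
    b / g (Z u) - a * (Z u - c) <= b / g (Z v) - a * (Z v - c) ->
    v - Z v <= u - Z u.
  move=> /ZP[/andP[_ uZ] ->] /ZP[/andP[_ vZ] ->].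
  rewrite !subKr ler_pM2l // lef_pV2 // ?posrE subr_gt0 //.
have Zm u v : u <= v -> Z u <= Z v.
  move=> le; have [vX|Xv] := leP v X0.
    by rewrite !ZN // (le_trans le).
  have [uX|Xu] := leP u X0.
    rewrite ZN //; have [/andP[/ltW + _] _] := ZP _ Xv; exact: le_trans.
  rewrite leNgt; apply/negP => ltZ.
  have [/andP[XZ _] _] := ZP _ Xv.
  have := outflow _ _ Xu Xv (inflow _ _ XZ (ltW ltZ)).
  by lra.
exists (fun y => y - Z y); last first.
  by move=> y /ZP; rewrite !subKr => -[/andP[-> _] ->].
split=> [y /ZP[/andP[_ +] _]|y /ZN->|u v le|u v le].
- by rewrite subr_gt0.
- by rewrite subrr.
- have [vX|Xv] := leP v X0.
    by rewrite !ZN ?subrr // (le_trans le).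
  have [uX|Xu] := leP u X0.
    rewrite ZN // subrr subr_ge0; have [/andP[_ /ltW]] := ZP _ Xv.
    done.
  apply: outflow => //; apply: inflow; last exact: Zm.
  by have [/andP[]] := ZP _ Xu.
- by rewrite !subKr Zm.
Qed.

Lemma gap_map_base (R : realType) (X0 : R) :
  gap_map X0 (fun y => Num.max (y - X0) 0).
Proof.
split=> [y lty|y ley|u v le|u v le].
- by rewrite lt_max subr_gt0 lty.
- by apply/max_idPr; rewrite subr_le0.
- by rewrite ge_max !le_max lexx lerD2r le orbT.
- by case: (leP (u - X0) 0); case: (leP (v - X0) 0); lra.
Qed.

(** Elimination of the nodes 1, ..., k: g y is the gap left of node k.+1 when
    that node is placed at y.  Recording x k = y - g y is what makes the flux
    at the next equation a function of y alone. *)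
Lemma reciprocal_balance_gap_map (R : realType) (a c b : nat -> R) (X0 : R)
    (M k : nat) :
  (forall i, (i.+1 < M)%N -> 0 < a i.+1) ->
  (forall k, (k < M)%N -> 0 < b k) ->
  (k < M)%N ->
  exists2 g, gap_map X0 g & forall y, X0 < y -> exists x : nat -> R,
    [/\ x 0 = X0, x k.+1 = y, x k = y - g y,
        forall i, (i < k.+1)%N -> x i < x i.+1
      & balance a c (fun k d => - (b k / d)) k.+1 x].
Proof.
move=> a0 b0; elim: k => [|k IHk] ltkM.
  exists (fun y => Num.max (y - X0) 0); first exact: gap_map_base.
  move=> y lty; exists (fun k => if k is 0 then X0 else y); split => //.
    by have /ltW := lty; rewrite -subr_ge0 => /max_idPl ->; rewrite subKr.
  by case.
have [g gg Hg] := IHk (ltnW ltkM).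
have [g' gg' Hg'] := gap_map_extend (c k.+1) gg (a0 k ltkM)
  (b0 k (ltnW ltkM)) (b0 k.+1 ltkM).
exists g' => // y lty; have [ltz ez] := Hg' y lty.
have [x [x0 xk xk' xinc xbal]] := Hg _ ltz.
have g'y : 0 < g' y by case: gg' => + _ _ _; apply.
exists (fun i => if (i <= k.+1)%N then x i else y); split => //.
- by rewrite ltnn.
- by rewrite leqnn.
- move=> i ltik; have [->|lti] : i = k.+1 \/ (i < k.+1)%N by lia.
    by rewrite leqnn ltnn xk ltrBlDr ltrDl.
  by rewrite lti (ltnW lti) xinc.
- move=> i ltik; have [->|lti] : i = k \/ (i < k)%N by lia.
    rewrite leqnn ltnn leqnSn xk xk' ez.
    by rewrite opprK !subKr addrC.
  rewrite !ifT; try lia.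
  exact: xbal.
Qed.

Lemma reciprocal_balance_exists (R : realType) (a c b : nat -> R) (M : nat)
    (x0 xM : R) :
  (0 < M)%N ->
  (forall i, (i.+1 < M)%N -> 0 < a i.+1) ->
  (forall k, (k < M)%N -> 0 < b k) ->
  x0 < xM ->
  exists x : nat -> R,
    [/\ balance a c (fun k d => - (b k / d)) M x,
        forall k, (k < M)%N -> x k < x k.+1, x 0 = x0 & x M = xM].
Proof.
case: M => // M _ a0 b0 lt_0M.
have [g _ /(_ _ lt_0M)[x [x00 xMM _ xinc Bx]]] :=
  reciprocal_balance_gap_map c x0 a0 b0 (ltnSn M).
by exists x.
Qed.

(** * The schemes as balance laws *)

Lemma nth_onE (R : realType) (X0 h : R) (M : nat) (f : R -> R) (i : nat) :
  (i < M.+1)%N -> (onE X0 h M f)`_i = f (gpoint X0 h i%:R).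
Proof. by move=> lti; exact: (nth_mktuple _ 0 (Ordinal lti)). Qed.

Lemma nth_onC (R : realType) (X0 h : R) (M : nat) (f : R -> R) (i : nat) :
  (i < M)%N -> (onC X0 h M f)`_i = f (gpoint X0 h (i%:R + 2^-1)).
Proof. by move=> lti; exact: (nth_mktuple _ 0 (Ordinal lti)). Qed.

Lemma nth_gdiv (R : realType) (n : nat) (u v : n.-tuple R) (i : nat) :
  (i < n)%N -> (gdiv u v)`_i = u`_i / v`_i.
Proof. by move=> lti; exact: (nth_mktuple _ 0 (Ordinal lti)). Qed.

Lemma nth_gpow (R : realType) (n : nat) (u : n.-tuple R) (s : R) (i : nat) :
  (i < n)%N -> (gpow u s)`_i = u`_i `^ s.
Proof. by move=> lti; exact: (nth_mktuple _ 0 (Ordinal lti)). Qed.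

Lemma nth_Dh (R : realType) (h : R) (M : nat) (l : gridE R M) (i : nat) :
  (i < M)%N -> (Dh h l)`_i = (l`_i.+1 - l`_i) / h.
Proof. by move=> lti; exact: (nth_mktuple _ 0 (Ordinal lti)). Qed.

Lemma gridE_eq (R : realType) (M : nat) (x y : gridE R M) :
  (forall i, (i <= M)%N -> x`_i = y`_i) -> x = y.
Proof. by move=> exy; apply: eq_from_tnth => i; rewrite !(tnth_nth 0) exy // -ltnS. Qed.

Lemma gridE_of_seq (R : realType) (M : nat) (u : nat -> R) :
  exists x : gridE R M, forall i, (i <= M)%N -> x`_i = u i.
Proof.
by exists [tuple u k | k < M.+1] => i leiM; exact: (nth_mktuple _ 0 (Ordinal (leiM : (i < M.+1)%N))).
Qed.

Lemma balance_eq_grid (R : realType) (a c : nat -> R) phi (M : nat)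
    (x y : nat -> R) :
  (forall i, (i <= M)%N -> y i = x i) ->
  balance a c phi M x -> balance a c phi M y.
Proof. by move=> e Bx i lti; rewrite !e ?Bx //; lia. Qed.

Lemma admissibleP (R : realType) (X0 h : R) (M : nat) (l : gridE R M) :
  admissible X0 h l <->
  [/\ forall k, (k < M)%N -> l`_k < l`_k.+1, l`_0 = X0
    & l`_M = gpoint X0 h M%:R].
Proof.
split=> -[linc l0 lM]; split=> //; first by move=> k ltk; exact: (linc k.+1).
by case=> // i lti; exact: linc.
Qed.

Lemma scheme1P (R : realType) (X0 h tau m : R) (M : nat) (f0 : R -> R)
    (xn x : gridE R M) :
  h != 0 ->
  scheme1 X0 h tau m f0 xn x <->
  [/\ balance
        (fun i => f0 (gpoint X0 h i%:R)
          / (m * (gpow (gdiv (onE X0 h M f0) (Dth h xn)) (m - 1))`_i) / tau)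
        (fun i => xn`_i)
        (fun k d => - (f0 (gpoint X0 h (k%:R + 2^-1)) / d)) M
        (fun i => x`_i),
      x`_0 = X0 & x`_M = gpoint X0 h M%:R].
Proof.
move=> h0.
have flux k : (k < M)%N -> (gdiv (onC X0 h M f0) (Dh h x))`_k / h =
    f0 (gpoint X0 h (k%:R + 2^-1)) / (x`_k.+1 - x`_k).
  move=> ltk; rewrite nth_gdiv // nth_onC // nth_Dh //.
  by rewrite invf_div mulrA mulrAC mulfK.
split=> -[Hx x0 xM]; split=> // i lti; last first.
  case: i lti => // i lti; rewrite /dh [in RHS]mulrBl /= !flux; [|lia..].
  by rewrite mulrA mulrAC Hx; [lra|lia].
rewrite -!flux; [|lia..].
have := Hx i.+1; rewrite /dh [in RHS]mulrBl /= mulrA mulrAC => ->; last by lia.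
by lra.
Qed.

Lemma scheme2P (R : realType) (X0 h tau m : R) (M : nat) (f0 : R -> R)
    (xn x : gridE R M) :
  scheme2 X0 h tau m f0 xn x <->
  [/\ balance
        (fun i => (gpow (Dth h xn) (m + 1))`_i
          / (m * f0 (gpoint X0 h i%:R) `^ m) / tau)
        (fun i => xn`_i)
        (fun k d => (f0 (gpoint X0 h (k%:R + 2^-1)))^-1 / h ^+ 2 * d) M
        (fun i => x`_i),
      x`_0 = X0 & x`_M = gpoint X0 h M%:R].
Proof.
have flux k : (k < M)%N -> (gdiv (Dh h x) (onC X0 h M f0))`_k / h =
    (f0 (gpoint X0 h (k%:R + 2^-1)))^-1 / h ^+ 2 * (x`_k.+1 - x`_k).
  move=> ltk; rewrite nth_gdiv // nth_onC // nth_Dh //.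
  by rewrite expr2 invfM; ring.
split=> -[Hx x0 xM]; split=> // i lti; last first.
  case: i lti => // i lti; rewrite /dh [in RHS]mulrBl /= !flux; [|lia..].
  by rewrite mulrA mulrAC Hx //; lia.
rewrite -!flux; [|lia..].
have := Hx i.+1; rewrite /dh [in RHS]mulrBl /= mulrA mulrAC => ->; last by lia.
by [].
Qed.

Lemma gpoint_inside (R : realType) (X0 X1 h r : R) (b0 b1 : bool) (M : nat) :
  X0 < X1 -> (0 < M)%N -> h = (X1 - X0) / M%:R -> 0 < r < M%:R ->
  gpoint X0 h r \in Interval (BSide b0 X0) (BSide b1 X1).
Proof.
move=> hX M0 hh /andP[r0 rM].
have M0' : 0 < M%:R :> R by rewrite ltr0n.
have h0 : 0 < h by rewrite hh divr_gt0 // subr_gt0.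
have hM : M%:R * h = X1 - X0 by rewrite hh mulrC divfK // gt_eqF.
have left : X0 < gpoint X0 h r by rewrite ltrDl mulr_gt0.
have right : gpoint X0 h r < X1.
  by rewrite /gpoint addrC -ltrBrDr -hM ltr_pM2r.
by case: b0; case: b1; rewrite in_itv /= ?left ?right ?(ltW left) ?(ltW right).
Qed.

(** The centred difference of an increasing sequence.  The one-sided values at
    the end nodes may be negative, hence the restriction to interior nodes. *)
Lemma Dth_gt0 (R : realType) (X0 h : R) (M i : nat) (l : gridE R M) :
  0 < h -> admissible X0 h l -> (i.+1 < M)%N -> 0 < (Dth h l)`_i.+1.
Proof.
move=> h0 /admissibleP[linc _ _] lti.
have lti' : (i.+1 < M.+1)%N by lia.
rewrite (nth_mktuple _ 0 (Ordinal lti')) /= ifF; last by lia.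
rewrite divr_gt0 ?mulr_gt0 // subr_gt0.
by apply: (lt_trans (linc i _)); [lia|apply: linc].
Qed.

Theorem theorem4p1 (R : realType) (X0 X1 T m : R) (b0 b1 : bool) (N M n : nat)
    (tau h : R) (f0 : R -> R) (xn : gridE R M)
    (hX : X0 < X1) (hT : 0 < T) (hN : (0 < N)%N) (hM : (0 < M)%N)
    (htau : tau = T / N%:R) (hh : h = (X1 - X0) / M%:R)
    (hm : 1 < m)
    (* Omega is a bounded interval with endpoints X0 and X1, each of which
       may or may not belong to it *)
    (hf0 : exists2 c : R, 0 < c &
       forall y : R, y \in Interval (BSide b0 X0) (BSide b1 X1) -> c <= f0 y)
    (hn : (n < N)%N) (hxn : admissible X0 h xn) :
  (exists! x : gridE R M, admissible X0 h x /\ scheme1 X0 h tau m f0 xn x) /\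
  ((exists! x : gridE R M, scheme2 X0 h tau m f0 xn x) /\
   (forall x : gridE R M, scheme2 X0 h tau m f0 xn x -> admissible X0 h x)).

Proof.
have M0' : 0 < M%:R :> R by rewrite ltr0n.
have h0 : 0 < h by rewrite hh divr_gt0 // subr_gt0.
have tau0 : 0 < tau by rewrite htau divr_gt0 // ltr0n.
have m0 : 0 < m by rewrite (lt_trans ltr01).
have [c c0 hc] := hf0.
have f_gt0 r : 0 < r < M%:R -> 0 < f0 (gpoint X0 h r).
  by move=> hr; apply: (lt_le_trans c0); apply: hc; exact: gpoint_inside hr.
have fE i : (i.+1 < M)%N -> 0 < f0 (gpoint X0 h i.+1%:R).
  by move=> lti; rewrite f_gt0 // ltr0n ltr_nat.
pose b k := f0 (gpoint X0 h (k%:R + 2^-1)).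
have b_gt0 k : (k < M)%N -> 0 < b k.
  move=> ltk; apply: f_gt0; have : k.+1%:R <= M%:R :> R by rewrite ler_nat.
  have : 0 <= k%:R :> R by rewrite ler0n.
  by rewrite -natr1; lra.
have X0M : X0 < gpoint X0 h M%:R by rewrite ltrDl mulr_gt0.
have D0 i (lti : (i.+1 < M)%N) := Dth_gt0 h0 hxn lti.
have /admissibleP[xninc xn0 xnM] := hxn.
split.
  pose a i := f0 (gpoint X0 h i%:R) /
    (m * (gpow (gdiv (onE X0 h M f0) (Dth h xn)) (m - 1))`_i) / tau.
  have a0 i : (i.+1 < M)%N -> 0 < a i.+1.
    rewrite /a => lti; have ltiM : (i.+1 < M.+1)%N by lia.
    rewrite !divr_gt0 ?fE ?mulr_gt0 // nth_gpow // powR_gt0 //.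
    by rewrite nth_gdiv // divr_gt0 ?D0 // nth_onE ?fE.
  have [u [Bu uinc u0 uM]] :=
    @reciprocal_balance_exists _ a (fun i => xn`_i) b _ _ _ hM a0 b_gt0 X0M.
  have [x xE] := gridE_of_seq M u.
  have x_adm : admissible X0 h x.
    by apply/admissibleP; split=> [k ltk||]; rewrite !xE ?uinc //; lia.
  have x_sch : scheme1 X0 h tau m f0 xn x.
    apply/scheme1P; first by rewrite gt_eqF.
    by split; rewrite ?xE //; exact: balance_eq_grid Bu.
  exists x; split=> // y [/admissibleP[yinc _ _] /scheme1P].
  rewrite gt_eqF // => /(_ isT)[By y0 yM].
  have /admissibleP[xinc _ _] := x_adm.
  have /scheme1P[|Bx x0 xM] := x_sch; first by rewrite gt_eqF.
  apply: gridE_eq; apply: (@balance_unique _ a _ _ Num.pos _ _ _ a0 _ _ _ Bx By).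
  - move=> k ltk d d' d0 d'0 le_dd'.
    by rewrite lerN2 ler_pM2l ?b_gt0 // lef_pV2.
  - by move=> k ltk; rewrite posrE subr_gt0 xinc.
  - by move=> k ltk; rewrite posrE subr_gt0 yinc.
  - by rewrite x0.
  - by rewrite xM.
pose a i := (gpow (Dth h xn) (m + 1))`_i /
  (m * f0 (gpoint X0 h i%:R) `^ m) / tau.
pose beta k := (f0 (gpoint X0 h (k%:R + 2^-1)))^-1 / h ^+ 2.
have a0 i : (i.+1 < M)%N -> 0 < a i.+1.
  rewrite /a => lti; have ltiM : (i.+1 < M.+1)%N by lia.
  by rewrite !divr_gt0 ?mulr_gt0 ?powR_gt0 ?fE // nth_gpow // powR_gt0 ?D0.
have beta0 k : (k < M)%N -> 0 < beta k.
  by move=> ltk; rewrite /beta divr_gt0 ?exprn_gt0 // invr_gt0 (b_gt0 k).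
split.
  have [u [Bu u0 uM]] := @linear_balance_exists _ a (fun i => xn`_i) beta _ X0
    (gpoint X0 h M%:R) hM a0 beta0.
  have [x xE] := gridE_of_seq M u.
  have x_sch : scheme2 X0 h tau m f0 xn x.
    by apply/scheme2P; split; rewrite ?xE //; exact: balance_eq_grid Bu.
  exists x; split=> // y /scheme2P[By y0 yM].
  have /scheme2P[Bx x0 xM] := x_sch.
  apply: gridE_eq; apply: (@balance_unique _ a _ _ predT _ _ _ a0 _ _ _ Bx By) => //.
  - by move=> k ltk d d' _ _ le_dd'; rewrite ler_pM2l ?beta0.
  - by rewrite x0.
  - by rewrite xM.
move=> x /scheme2P[Bx x0 xM]; apply/admissibleP; split=> //.
apply: (@linear_balance_increasing _ a _ beta _ _ a0 beta0 xninc Bx).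
- by rewrite x0.
- by rewrite xM.
Qed.
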